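(* Let $R$ be a commutative Noetherian ring of dimension $n\ge 3$ containing $\mathbb Q$. Let $E(R)=G/H_1$ be the Euler class group of $R$ and let $\widetilde E(R)=G/H$ be the group defined by homotopy relations (both defined in the context). Then $\widetilde E(R)\simeq E(R)$.
   Context: Let $G$ be the free abelian group on the set of pairs $(\mathfrak n,\omega_{\mathfrak n})$, where $\mathfrak n$ is an $\mathfrak m$-primary ideal of $R$ of height $n$ (for some maximal ideal $\mathfrak m$ of $R$) such that $\mathfrak n/\mathfrak n^2$ is minimally generated by $n$ elements, $\mu(\mathfrak n/\mathfrak n^2)=n$, and $\omega_{\mathfrak n}:(R/\mathfrak n)^n\twoheadrightarrow \mathfrak n/\mathfrak n^2$ is a surjection. Let $J\subset R$ be an ideal of height $n$ with $\mu(J/J^2)=n$ and let $\omega_J:(R/J)^n\twoheadrightarrow J/J^2$ be a surjection. If $J=\bigcap_{i=1}^r\mathfrak n_i$ is the irredundant primary decomposition of $J$ (each $\mathfrak n_i$ is primary to a maximal ideal of height $n$), then $\omega_J$ induces surjections $\omega_{\mathfrak n_i}:(R/\mathfrak n_i)^n\twoheadrightarrow \mathfrak n_i/\mathfrak n_i^2$, and one writes $(J,\omega_J):=\sum_{i=1}^r(\mathfrak n_i,\omega_{\mathfrak n_i})\in G$. Definition of $E(R)$: $H_1$ is the subgroup of $G$ generated by the elements $(J,\omega_J)$ for which $\omega_J$ has a lift to a surjection $\theta:R^n\twoheadrightarrow J$; $E(R):=G/H_1$. Definition of $\widetilde E(R)$: For an ideal $I\subset R[T]$, $I(0)$ and $I(1)$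 denote the ideals of $R$ obtained by putting $T=0$ and $T=1$. Let $S$ be the set of elements of $G$ of the form $(J,\omega_J)=(I(0),\omega(0))-(I(1),\omega(1))$ where (i) $I\subset R[T]$ is an ideal of height $n$ such that $I=(f_1,\dots,f_n)$; (ii) both $I(0)$ and $I(1)$ are ideals of height $n$; (iii) $\omega(0):(R/I(0))^n\twoheadrightarrow I(0)/I(0)^2$ and $\omega(1):(R/I(1))^n\twoheadrightarrow I(1)/I(1)^2$ are induced by $\{f_1(0),\dots,f_n(0)\}$ and $\{f_1(1),\dots,f_n(1)\}$, respectively. $H$ is the subgroup of $G$ generated by $S$, and $\widetilde E(R):=G/H$.
   Formalization: In the relations defining Ẽ(R), I(0) and I(1) may each have height n or be the unit ideal R (whose cycle is 0); if both had to be proper, the claim would fail for R local, e.g. Q[[x,y,z]], where E(R)=0 but Ẽ(R) maps onto Z. *)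

(* Defs.v *)
(* MathComp, with the classical reasoning of mathcomp-classical. *)
From HB Require Import structures.
From mathcomp Require Import all_boot all_order all_algebra.
From mathcomp Require Import ring_quotient generic_quotient.
From mathcomp Require Import boolp classical_sets.
From mathcomp Require Import freeg.

Set Implicit Arguments.
Unset Strict Implicit.
Unset Printing Implicit Defensive.

Import GRing.Theory.

Local Open Scope classical_set_scope.
Local Open Scope ring_scope.
Local Open Scope quotient_scope.

(* The library's [idealr] only contains proper ideals; I(0), I(1) may be the
   unit ideal, so an unrestricted notion of ideal is needed. *)
HB.mixin Record isMulAbsorbing (R : comNzRingType) (I : R -> bool) := {
  ideal_mull : forall a, {in I, forall x, a * x \in I}
}.

#[short(type="ideal")]
HB.structure Definition Ideal (R : comNzRingType) :=
  {I of GRing.ZmodClosed R I & isMulAbsorbing R I}.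

Section IdealConstructions.
Variable R : comNzRingType.
Implicit Types (I : ideal R) (S : set R).

Definition ideal_gen S : R -> bool :=
  fun x => `[< forall I, S `<=` [set` I] -> x \in I >].

Lemma ideal_gen_zmod_closed S : zmod_closed (ideal_gen S).
Proof.
split=> [|x y /asboolP hx /asboolP hy]; apply/asboolP=> I SI.
  exact: rpred0.
by apply: rpredB; [exact: hx | exact: hy].
Qed.
HB.instance Definition _ S :=
  GRing.isZmodClosed.Build R (ideal_gen S) (ideal_gen_zmod_closed S).

Lemma ideal_gen_mull S a : {in ideal_gen S, forall x, a * x \in ideal_gen S}.
Proof.
move=> x /asboolP hx; apply/asboolP=> I SI.
by apply: ideal_mull; exact: hx.
Qed.
HB.instance Definition _ S :=
  isMulAbsorbing.Build R (ideal_gen S) (@ideal_gen_mull S).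

Definition ideal_sq I : ideal R :=
  Ideal.clone R (ideal_gen [set x * y | x in [set` I] & y in [set` I]]) _.

(* For an ideal I of R[T], [ideal_at I a] is the ideal obtained by T := a. *)
Definition eval_pred (I : ideal {poly R}) (a : R) : R -> bool :=
  fun x => `[< exists2 p, p \in I & p.[a] = x >].

Lemma eval_pred_zmod_closed (I : ideal {poly R}) a :
  zmod_closed (eval_pred I a).
Proof.
split=> [|x y /asboolP[p pI <-] /asboolP[q qI <-]]; apply/asboolP.
  by exists 0; rewrite ?rpred0 ?horner0.
by exists (p - q); rewrite ?rpredB // hornerD hornerN.
Qed.
HB.instance Definition _ (I : ideal {poly R}) a :=
  GRing.isZmodClosed.Build R (eval_pred I a) (eval_pred_zmod_closed I a).

Lemma eval_pred_mull (I : ideal {poly R}) a b :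
  {in eval_pred I a, forall x, b * x \in eval_pred I a}.
Proof.
move=> x /asboolP[p pI <-]; apply/asboolP; exists (b%:P * p).
  exact: ideal_mull.
by rewrite hornerM hornerC.
Qed.
HB.instance Definition _ (I : ideal {poly R}) a :=
  isMulAbsorbing.Build R (eval_pred I a) (@eval_pred_mull I a).

Definition ideal_at (I : ideal {poly R}) (a : R) : ideal R :=
  Ideal.clone R (eval_pred I a) _.

End IdealConstructions.

(* R/I as an R-module, I being possibly the unit ideal. *)
Section QuotientModule.
Variables (R : comNzRingType) (I : ideal R).

Definition modq : Type := {ideal_quot I}.
HB.instance Definition _ := GRing.Zmodule.on modq.

Definition cls (x : R) : modq := \pi_{ideal_quot I} x.

Lemma cls_eq x y : (cls x = cls y) <-> (x - y \in I).
Proof.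
rewrite Quotient.idealrBE; split=> [h|/eqP h //].
by apply/eqP; exact: h.
Qed.

Lemma clsD x y : cls (x + y) = cls x + cls y.
Proof. exact: (raddfD (\pi_{ideal_quot I})). Qed.

Definition cls_repr (u : modq) : R := repr (u : {ideal_quot I}).

Lemma cls_reprK u : cls (cls_repr u) = u.
Proof. exact: reprK. Qed.

Definition modq_scale (a : R) (u : modq) : modq := cls (a * cls_repr u).

Lemma modq_scaleE a x : modq_scale a (cls x) = cls (a * x).
Proof.
apply/cls_eq; rewrite -mulrBr; apply: ideal_mull; apply/cls_eq.
exact: cls_reprK.
Qed.

Lemma modq_scaleA a b u :
  modq_scale a (modq_scale b u) = modq_scale (a * b) u.
Proof. by rewrite -[u]cls_reprK !modq_scaleE mulrA. Qed.
Lemma modq_scale1 : left_id 1 modq_scale.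
Proof. by move=> u; rewrite -[u]cls_reprK modq_scaleE mul1r. Qed.
Lemma modq_scaleDr : right_distributive modq_scale +%R.
Proof.
move=> a u v; rewrite -[u]cls_reprK -[v]cls_reprK -clsD !modq_scaleE.
by rewrite mulrDr clsD.
Qed.
Lemma modq_scaleDl u : {morph modq_scale^~ u : a b / a + b}.
Proof. by move=> a b; rewrite -[u]cls_reprK !modq_scaleE mulrDl clsD. Qed.

HB.instance Definition _ := GRing.Zmodule_isLmodule.Build R modq
  modq_scaleA modq_scale1 modq_scaleDr modq_scaleDl.

End QuotientModule.

Section CommutativeAlgebra.
Variable R : comNzRingType.
Implicit Types (I m q : ideal R) (P : prime_idealr R).

Definition spanned (M : lmodType R) k (g : 'I_k -> M) : set M :=
  [set \sum_i c i *: g i | c in [set: 'I_k -> R]].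

Definition mu (M : lmodType R) (N : set M) (k : nat) : Prop :=
  (exists g : 'I_k -> M, spanned g = N) /\
  (forall l (g : 'I_l -> M), spanned g = N -> (k <= l)%N).

Definition noetherian : Prop :=
  forall I, exists k (g : 'I_k -> R^o), [set` I] = spanned g.

(* A strictly increasing chain of k + 1 primes with largest member P. *)
Definition prime_chain P (k : nat) : Prop :=
  exists p : 'I_k.+1 -> prime_idealr R,
    (forall i j : 'I_k.+1, (i < j)%N -> [set` p i] `<` [set` p j]) /\
    [set` p ord_max] = [set` P].

Definition krull_dim (d : nat) : Prop :=
  (exists P, prime_chain P d) /\
  (forall P k, prime_chain P k -> (k <= d)%N).

Definition prime_height P (h : nat) : Prop :=
  prime_chain P h /\ (forall k, prime_chain P k -> (k <= h)%N).

(* The minimum of the heights of the primes containing I; in particular the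
   unit ideal has no height h : nat. *)
Definition height I (h : nat) : Prop :=
  (exists P, [set` I] `<=` [set` P] /\ prime_height P h) /\
  (forall P, [set` I] `<=` [set` P] -> prime_chain P h).

Definition unit_ideal I : Prop := [set` I] = setT.

Definition maximal_ideal m : Prop :=
  ~ unit_ideal m /\
  (forall I, [set` m] `<=` [set` I] -> [set` I] = [set` m] \/ unit_ideal I).

Definition radical I : set R := [set x | exists k : nat, x ^+ k \in I].

Definition primary q : Prop :=
  ~ unit_ideal q /\
  (forall x y, x * y \in q -> x \in q \/ radical q y).

Definition primary_to m q : Prop := primary q /\ radical q = [set` m].

Definition irredundant_decomposition I r (q : 'I_r -> ideal R) : Prop :=
  [/\ [set` I] = \bigcap_i [set` q i],
      forall i, primary (q i),
      forall i j, i != j -> radical (q i) <> radical (q j)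
    & forall i, ~ (\bigcap_(j in [set j | j != i]) [set` q j] `<=` [set` q i])].

End CommutativeAlgebra.

Section Symbols.
Variables (R : comNzRingType) (n : nat).
Implicit Types J : ideal R.

(* J/J^2, as a submodule of R/J^2. *)
Definition conormal J : set (modq (ideal_sq J)) := cls (ideal_sq J) @` [set` J].
Arguments conormal : clear implicits.

(* Surjections (R/J)^n ->> J/J^2. Linearity over R is the same as over R/J. *)
Record surjection J := Surjection {
  surj_fun :> {linear {ffun 'I_n -> modq J} -> modq (ideal_sq J)};
  surj_range : range surj_fun = conormal J
}.

Definition clsv J (v : {ffun 'I_n -> R^o}) : {ffun 'I_n -> modq J} :=
  [ffun i => cls J (v i)].

Record symbol := Symbol {
  sym_ideal : ideal R;
  sym_primary : exists m, maximal_ideal m /\ primary_to m sym_ideal;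
  sym_height : height sym_ideal n;
  sym_mu : mu (conormal sym_ideal) n;
  sym_surj : surjection sym_ideal
}.

HB.instance Definition _ := gen_eqMixin symbol.
HB.instance Definition _ := gen_choiceMixin symbol.

Definition symbol_group : zmodType := {freeg symbol / int}.

(* For J contained in q, the square formed by wJ, wq and the natural maps
   (R/J)^n -> (R/q)^n and J/J^2 -> q/q^2 commutes. *)
Definition induces J q (wJ : surjection J) (wq : surjection q) : Prop :=
  forall v x, x \in J -> wJ (clsv J v) = cls (ideal_sq J) x ->
    wq (clsv q v) = cls (ideal_sq q) x.

(* g is the element (J, w) of [symbol_group]. If J is the unit ideal, then
   r = 0 and g = 0. *)
Definition cycle_of J (w : surjection J) (g : symbol_group) : Prop :=
  exists r (s : 'I_r -> symbol),
    [/\ irredundant_decomposition J (fun i => sym_ideal (s i)),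
        forall i, induces w (sym_surj (s i))
      & g = \sum_i << s i >>].

Definition lifts J (w : surjection J) : Prop :=
  exists theta : {linear {ffun 'I_n -> R^o} -> R^o},
    range theta = [set` J] /\
    (forall v, cls (ideal_sq J) (theta v) = w (clsv J v)).

(* w maps the i-th basis vector to the class of f i. *)
Definition induced_by J (w : surjection J) (f : 'I_n -> R) : Prop :=
  forall i, w (clsv J [ffun j => (j == i)%:R]) = cls (ideal_sq J) (f i).

Definition lifted_cycles : set symbol_group :=
  [set g | exists J (w : surjection J),
     [/\ height J n, mu (conormal J) n, lifts w & cycle_of w g]].

(* The unit ideal, whose cycle is 0, is allowed for I(0) and I(1), as usual for
   homotopies of cycles. Without it the relations would preserve the number of
   symbols when R is local, and E and E~ would differ. *)
Definition height_or_unit J : Prop := height J n \/ unit_ideal J.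

Definition homotopy_relations : set symbol_group :=
  [set g | exists (I : ideal {poly R}) (f : 'I_n -> {poly R})
      (w0 : surjection (ideal_at I 0)) (w1 : surjection (ideal_at I 1))
      (g0 g1 : symbol_group),
    [/\ height I n /\ [set` I] = spanned (f : 'I_n -> {poly R}^o),
        height_or_unit (ideal_at I 0) /\ height_or_unit (ideal_at I 1),
        induced_by w0 (fun i => (f i).[0]) /\ induced_by w1 (fun i => (f i).[1]),
        cycle_of w0 g0 /\ cycle_of w1 g1
      & g = g0 - g1]].

End Symbols.

Section GeneratedSubgroup.
Variables (V : zmodType) (S : set V).

Definition subgroup_pred : V -> bool :=
  fun x => `[< forall K : zmodClosed V, S `<=` [set` K] -> x \in K >].

Lemma subgroup_pred_zmod_closed : zmod_closed subgroup_pred.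
Proof.
split=> [|x y /asboolP hx /asboolP hy]; apply/asboolP=> K SK.
  exact: rpred0.
by apply: rpredB; [exact: hx | exact: hy].
Qed.
HB.instance Definition _ :=
  GRing.isZmodClosed.Build V subgroup_pred subgroup_pred_zmod_closed.

Definition subgroup_gen : zmodClosed V :=
  GRing.ZmodClosed.clone V subgroup_pred _.

End GeneratedSubgroup.

(* E(R) and E~(R), for n the dimension of R. *)
Definition euler_class_group (R : comNzRingType) (n : nat) : zmodType :=
  Quotient.quot (subgroup_gen (@lifted_cycles R n)).

Definition homotopy_class_group (R : comNzRingType) (n : nat) : zmodType :=
  Quotient.quot (subgroup_gen (@homotopy_relations R n)).

(* Main.v *)
(* Both groups are quotients of G by the same subgroup. The ends I(0) and I(1)
   of a homotopy are generated by the f_i(0) and the f_i(1), so their cycles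
   lift. Conversely, if J is generated by f_1, .., f_n inducing w, then, for
   c_1, .., c_n generic in R[T], the elements f_1 + T (1 - f_1) + T (1 - T) c_1
   and f_i + T (1 - T) c_i, i > 1, generate an ideal of height n, whose end at
   T = 0 is (J, w) and whose end at T = 1 is the unit ideal, with cycle 0. By
   prime avoidance the height is at least n away from T (1 - T) = 0; it is at
   most n by Krull's height theorem in R[T]. *)
From Stdlib Require List.
From HB Require Import structures.
Require Import Defs.
From mathcomp Require Import all_boot all_order all_algebra.
From mathcomp Require Import ring_quotient boolp classical_sets freeg.

Set Implicit Arguments.
Unset Strict Implicit.
Unset Printing Implicit Defensive.

Import GRing.Theory.

Local Open Scope classical_set_scope.
Local Open Scope ring_scope.

(** * Spans, ideals and prime ideals *)

Lemma mem_spanned (R : comNzRingType) (M : lmodType R) k (g : 'I_k -> M) i :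
  spanned g (g i).
Proof.
exists (fun j => (j == i)%:R) => //.
rewrite (bigD1 i) //= eqxx scale1r big1 ?addr0 // => j /negPf->.
by rewrite scale0r.
Qed.

Section Ideals.
Variable S : comNzRingType.
Implicit Types (I J K : ideal S) (P Q : prime_idealr S) (A : set S).

Lemma ideal_of_set A : A 0 -> (forall x y, A x -> A y -> A (x + y)) ->
    (forall a x, A x -> A (a * x)) ->
  exists I : ideal S, forall x, (x \in I) <-> A x.
Proof.
move=> A0 AD AM; pose p x := `[< A x >].
have pB : zmod_closed p.
  split=> [|x y /asboolP Ax /asboolP Ay]; first exact/asboolP.
  by apply/asboolP/AD => //; rewrite -mulN1r; apply: AM.
have pM a : {in p, forall x, a * x \in p}.
  by move=> x /asboolP Ax; apply/asboolP/AM.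
pose I : ideal S := HB.pack p (GRing.isZmodClosed.Build S p pB)
  (isMulAbsorbing.Build S p pM).
by exists I => x; split=> /asboolP.
Qed.

Lemma prime_of_ideal I : 1 \notin I ->
    (forall x y, x * y \in I -> x \in I \/ y \in I) ->
  exists P, forall x, (x \in P) = (x \in I).
Proof.
move=> I1 IM; pose p (x : S) := x \in I.
have pB : zmod_closed p by split; [exact: rpred0 | exact: rpredB].
have pI : 1 \notin p /\ forall a, {in p, forall u, a * u \in p}.
  by split=> // a x; exact: ideal_mull.
have pM : @prime_idealr_closed S p by move=> x y /IM[] ->; rewrite ?orbT.
pose P : prime_idealr S := HB.pack p (GRing.isZmodClosed.Build S p pB)
  (isProperIdeal.Build S p pI) (isPrimeIdealrClosed.Build S p pM).
by exists P.
Qed.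

Lemma ideal_of_prime P : exists I, forall x, (x \in I) = (x \in P).
Proof.
have [|x y|a x|I IP] := @ideal_of_set [set` P].
- exact: rpred0.
- exact: rpredD.
- exact: idealMr.
by exists I => x; apply/idP/idP => /IP.
Qed.

Lemma ideal_add_principal I a : exists K, [/\ {subset I <= K}, a \in K &
  forall x, x \in K <-> exists2 y, y \in I & exists t, x = y + t * a].
Proof.
have [|_ _ [x xI [s ->]] [y yI [t ->]]|b _ [y yI [t ->]]|K KP] := @ideal_of_set
    (fun x => exists2 y, y \in I & exists t, x = y + t * a).
- by exists 0; [exact: rpred0 | exists 0; rewrite mul0r addr0].
- exists (x + y); first exact: rpredD.
  by exists (s + t); rewrite mulrDl addrACA.
- exists (b * y); first exact: ideal_mull.
  by exists (b * t); rewrite mulrDr mulrA.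
exists K; split=> // [x xI|]; apply/KP.
  by exists x => //; exists 0; rewrite mul0r addr0.
by exists 0; [exact: rpred0 | exists 1; rewrite mul1r add0r].
Qed.

(** Equality of structures is needed because the type [surjection n J] depends on [J]. The closure
    conditions are propositions, so by proof irrelevance only the carriers matter. *)
Lemma ideal_eq I J : [set` I] = [set` J] -> I = J.
Proof.
move=> IJ; have {IJ} : Ideal.sort I = Ideal.sort J.
  apply/funext => x; apply/idP/idP => xI.
    by have : [set` I] x by []; rewrite IJ.
  by have : [set` J] x by []; rewrite -IJ.
case: I J => [I [[cI1] [cI2] [cI3]]] [J [[cJ1] [cJ2] [cJ3]]] /= IJ.
subst J; rewrite (Prop_irrelevance cI1 cJ1) (Prop_irrelevance cI2 cJ2).
by rewrite (Prop_irrelevance cI3 cJ3).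
Qed.

End Ideals.

(** * Noetherian rings and Hilbert's basis theorem *)

Definition max_principle (S : comNzRingType) : Prop :=
  forall F : set (ideal S), (exists I, F I) ->
  exists2 I, F I & forall J, F J -> {subset I <= J} -> {subset J <= I}.

(** Otherwise [F] contains an infinite strictly ascending sequence; its union is a finitely
    generated ideal, hence equal to one of its members. *)
Lemma noetherian_max_principle (R : comNzRingType) :
  noetherian R -> max_principle R.
Proof.
move=> noeR F [I0 FI0]; apply: contrapT => nomax.
have step (I : {I | F I}) : exists J : {I | F I},
    {subset sval I <= sval J} /\ ~ {subset sval J <= sval I}.
  apply: contrapT => nJ; apply: nomax; exists (sval I); first exact: svalP.
  move=> J FJ IJ; apply: contrapT => nJI; apply: nJ.
  by exists (exist _ J FJ).
have [nxt nxtP] := choice step.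
pose u k := iter k nxt (exist _ I0 FI0).
have mono k m : (k <= m)%N -> {subset sval (u k) <= sval (u m)}.
  elim: m => [|m IHm]; first by rewrite leqn0 => /eqP->.
  rewrite leq_eqVlt => /predU1P[-> //|/IHm km x xu].
  exact/(nxtP (u m)).1/km.
have [|x y [k xk] [m ym]|a x [k xk]|U UP] :=
  @ideal_of_set R (fun x => exists k, x \in sval (u k)).
- by exists 0%N; exact: rpred0.
- exists (maxn k m); apply: rpredD.
    exact: mono (leq_maxl _ _) _ xk.
  exact: mono (leq_maxr _ _) _ ym.
- by exists k; exact: ideal_mull.
have [k [g gU]] := noeR U.
have /choice[e eP] (i : 'I_k) : exists e, g i \in sval (u e).
  apply/UP; have : [set` U] (g i); last by [].
  by rewrite gU; exact: mem_spanned.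
pose m := \max_i e i.
apply: (nxtP (u m)).2 => x xm.
have : [set` U] x by apply/UP; exists m.+1.
rewrite gU => -[c _ <-]; apply: rpred_sum => i _.
by apply: ideal_mull; apply: mono (eP i); exact: leq_bigmax.
Qed.

(* Hilbert's basis theorem: [I] is determined, among the ideals containing it,
   by the ideals of leading coefficients of its elements of given degree. *)
Lemma max_principle_poly (R : comNzRingType) :
  max_principle R -> max_principle {poly R}.
Proof.
move=> maxR F [I0 FI0].
(* Coefficients in degree [d] of the elements of degree at most [d]: the size bound, rather than an
   exact degree, lets 0 be a member. *)
have /choice[L0 L0P] (Id : ideal {poly R} * nat) : exists K : ideal R, forall x,
    x \in K <-> exists2 p, p \in Id.1 & (size p <= Id.2.+1)%N /\ p`_Id.2 = x.
  case: Id => I d /=; apply: ideal_of_set.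
  - by exists 0; [exact: rpred0 | rewrite size_poly0 coef0].
  - move=> _ _ [p pI [sp <-]] [q qI [sq <-]].
    exists (p + q); first exact: rpredD.
    by rewrite coefD (leq_trans (size_polyD _ _)) // geq_max sp.
  - move=> a _ [p pI [sp <-]]; exists (a%:P * p); first exact: ideal_mull.
    by rewrite coefCM mul_polyC (leq_trans (size_scale_leq _ _)).
pose L (I : ideal {poly R}) d := L0 (I, d).
have LP (I : ideal {poly R}) d x : x \in L I d <->
    exists2 p, p \in I & (size p <= d.+1)%N /\ p`_d = x by exact: L0P.
have LS (I J : ideal {poly R}) d : {subset I <= J} -> {subset L I d <= L J d}.
  by move=> IJ x /LP[p pI h]; apply/LP; exists p => //; exact: IJ.
have LS1 (I : ideal {poly R}) d e : (d <= e)%N -> {subset L I d <= L I e}.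
  move=> /subnK <- x; elim: (e - d)%N => // k IHk /IHk/LP[p pI [sp <-]].
  apply/LP; exists ('X * p); first exact: ideal_mull.
  split; last by rewrite addSn /= coefXM.
  have [->|p0] := eqVneq p 0; first by rewrite mulr0 size_poly0.
  by rewrite mulrC size_mulX // addSn ltnS.
have Ldet (I J : ideal {poly R}) : {subset I <= J} ->
    (forall d, {subset L J d <= L I d}) -> {subset J <= I}.
  move=> IJ LJI p; elim: {p}(size p) {-2}p (leqnn (size p)) => [|d IHd] p.
    by rewrite leqn0 size_poly_eq0 => /eqP-> _; exact: rpred0.
  move=> sp pJ; have /LJI/LP[q qI [sq qd]] : p`_d \in L J d.
    by apply/LP; exists p.
  rewrite -[p](subrK q) rpredD // IHd ?rpredB ?(IJ q) //.
  apply/leq_sizeP => i; rewrite leq_eqVlt => /predU1P[<-|di].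
    by rewrite coefB qd subrr.
  by rewrite coefB !nth_default ?subrr // (leq_trans _ di).
(* Finitely many degrees are treated in turn: the highest first, then the lower ones among the
   ideals containing the one found. *)
have low k : forall (F' : set (ideal {poly R})), (exists I, F' I) ->
    exists2 I, F' I & forall J, F' J -> {subset I <= J} ->
      forall e, (e < k)%N -> {subset L J e <= L I e}.
  elim: k => [|k IHk] F' [I' FI']; first by exists I'.
  have [|_ [I1 FI1 <-] I1max] :=
      maxR [set L I k | I in F'].
    by exists (L I' k), I'.
  have [|I [FI I1I] Imax] :=
      IHk [set J : ideal {poly R} | F' J /\ {subset I1 <= J}].
    by exists I1; split.
  exists I => // J FJ IJ e; rewrite ltnS leq_eqVlt => /predU1P[->|ed].
    have I1J : {subset I1 <= J} by move=> x /I1I/IJ.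
    move=> x xJ; apply: (LS I1) => //.
    by apply: (I1max (L J k)) => //; [exists J | exact: LS].
  apply: Imax => //; split=> // x /I1I; exact: IJ.
(* [L I1 d] is maximal over all members of [F] and all degrees, so the members of [F] above [I1]
   share it in every degree from [d] on. Only the degrees below [d] remain. *)
have [|_ [[I1 d] /= FI1 <-] I1max] :=
    maxR [set L Id.1 Id.2 | Id in [set Id | F Id.1]].
  by exists (L I0 0%N), (I0, 0%N).
have [|I [FI I1I] Imax] :=
    low d [set J : ideal {poly R} | F J /\ {subset I1 <= J}].
  by exists I1; split.
exists I => // J FJ IJ; apply: Ldet => // e.
have I1J : {subset I1 <= J} by move=> x /I1I/IJ.
have [ed|de] := ltnP e d; first exact: Imax.
move=> x xJ; apply: (LS I1) => //; apply: (LS1 _ d) => //.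
apply: (I1max (L J e)) => //; first by exists (J, e).
by move=> y /(LS _ _ _ I1J)/(LS1 _ _ _ de).
Qed.

(** * Minimal primes and prime avoidance *)

Section NoetherianPrimes.
Variable S : comNzRingType.
Hypothesis maxS : max_principle S.
Implicit Types (I J K M N : ideal S) (P Q : prime_idealr S) (A : set S).

Lemma noetherian_ind (C : ideal S -> Prop) :
    (forall I, (forall J, {subset I <= J} -> ~ {subset J <= I} -> C J) ->
      C I) ->
  forall I, C I.
Proof.
move=> step I; apply: contrapT => nCI.
have [|J nCJ Jmax] := maxS (F := [set J | ~ C J]); first by exists I.
apply: nCJ; apply: step => J' JJ' nJJ'; apply: contrapT => nCJ'.
by apply: nJJ'; exact: Jmax.
Qed.

Lemma notin_mulr P x y : x \notin P -> y \notin P -> x * y \notin P.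
Proof. by rewrite prime_idealrM negb_or => -> ->. Qed.

Lemma notin_expr P x k : x \notin P -> x ^+ k \notin P.
Proof.
move=> xP; elim: k => [|k IHk]; first by rewrite expr0 idealr1.
by rewrite exprS notin_mulr.
Qed.

(** An ideal maximal among those that contain [K] and avoid [M] is prime: adjoining [x] or [y] from
    outside it creates an element of [M], and the product of the two lies in [M], and in the ideal
    if [x * y] does. *)
Lemma prime_disjoint K (M : set S) : M 1 ->
    (forall x y, M x -> M y -> M (x * y)) -> (forall x, x \in K -> ~ M x) ->
  exists P, {subset K <= P} /\ forall x, x \in P -> ~ M x.
Proof.
move=> M1 MM KM.
have [|I [KI IM] Imax] := maxS (F := [set I : ideal S |
    {subset K <= I} /\ forall x, x \in I -> ~ M x]); first by exists K; split.
have meet x : x \notin I -> exists2 m, M m & exists2 y, y \in I &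
    exists t, m = y + t * x.
  move=> xI; apply: contrapT => nm.
  have [K' [IK' xK' K'P]] := ideal_add_principal I x.
  move/negP: xI; apply; apply: (Imax K') => //.
  by split=> [y /KI/IK' //|y /K'P h My]; apply: nm; exists y.
have [||P PI] := @prime_of_ideal S I.
- by apply/negP => /IM.
- move=> x y xyI; apply: contrapT => /not_orP[/negP/meet[m Mm [u uI [t mE]]]].
  move=> /negP/meet[m' Mm' [v vI [s mE']]].
  apply: (IM (m * m')); last exact: MM.
  rewrite {1}mE mulrDl rpredD //; first by rewrite mulrC ideal_mull.
  rewrite mE' mulrDr rpredD //; first exact: ideal_mull.
  by rewrite mulrACA ideal_mull.
by exists P; split=> [x /KI|x]; rewrite PI //; exact: IM.
Qed.

(** Noetherian induction: if [x * y] lies in [I] and neither factor does, each prime over [I] is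
    over [I + (x)] or [I + (y)], and the two lists are joined. *)
Lemma primes_over I : exists l : seq (prime_idealr S),
  (forall P, List.In P l -> {subset I <= P}) /\
  (forall P, {subset I <= P} -> exists2 Q, List.In Q l & {subset Q <= P}).
Proof.
elim/noetherian_ind: I => I IHI.
have [I1|I1] := boolP (1 \in I).
  by exists [::]; split=> // P /(_ _ I1); rewrite idealr1.
have [Iprime|] := pselect (forall x y, x * y \in I -> x \in I \/ y \in I).
  have [P PI] := prime_of_ideal I1 Iprime.
  exists [:: P]; split=> [Q [<-|//] x|Q IQ]; first by rewrite PI.
  by exists P; [left | move=> x; rewrite PI => /IQ].
move=> /existsNP[x /existsNP[y /not_implyP[xyI /not_orP[xI yI]]]].
have add z : z \notin I -> exists K, [/\ {subset I <= K}, z \in K,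
    (forall Q, {subset I <= Q} -> z \in Q -> {subset K <= Q})
    & exists l : seq (prime_idealr S),
        (forall P, List.In P l -> {subset K <= P}) /\
        (forall P, {subset K <= P} ->
           exists2 Q, List.In Q l & {subset Q <= P})].
  move=> zI; have [K [IK zK KP]] := ideal_add_principal I z.
  exists K; split=> //; last by apply: IHI => // /(_ _ zK); exact/negP.
  move=> Q IQ zQ _ /KP[u /IQ uQ [t ->]]; apply: rpredD => //.
  exact: idealMr.
have [K [IK xK Kmin [l [lK lmin]]]] := add x (introN idP xI).
have [K' [IK' yK' Kmin' [l' [lK' lmin']]]] := add y (introN idP yI).
exists (l ++ l'); split=> [P /List.in_app_iff[/lK KP|/lK' KP] z|P IP].
- by move=> /IK/KP.
- by move=> /IK'/KP.
have := IP _ xyI; rewrite prime_idealrM => /orP[xP|yP].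
  have [Q Ql QP] := lmin _ (Kmin P IP xP).
  by exists Q => //; apply/List.in_app_iff; left.
have [Q Ql QP] := lmin' _ (Kmin' P IP yP).
by exists Q => //; apply/List.in_app_iff; right.
Qed.

(** A minimal member of the finite list from [primes_over] is minimal among all primes over [I],
    since each of these contains a member of the list. *)
Lemma minimal_prime_over I : 1 \notin I -> exists P, {subset I <= P} /\
  forall Q, {subset I <= Q} -> {subset Q <= P} -> {subset P <= Q}.
Proof.
move=> I1; have [l [lI lmin]] := primes_over I.
have [P IP] : exists P, {subset I <= P}.
  have [|x y -> ->|x xI x1|P [IP _]] := @prime_disjoint I [set 1].
  - by [].
  - exact: mulr1.
  - by rewrite -x1 xI in I1.
  by exists P.
have [Q Ql Qmin] : exists2 Q, List.In Q l &
    forall Q', List.In Q' l -> {subset Q' <= Q} -> {subset Q <= Q'}.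
  have [{P IP} Q Ql _] := lmin P IP; elim: l Q Ql {lI lmin} => // P l IHl Q _.
  have [[Q' Q'l]|nl] := pselect (exists Q', List.In Q' l); last first.
    exists P; first by left.
    by move=> Q' [->//|Q'l]; case: nl; exists Q'.
  have [{Q'l}Q' Q'l Q'min] := IHl _ Q'l.
  have [PQ'|nPQ'] := pselect {subset P <= Q'}.
    exists P; [by left | move=> Q2 [->//|Q2l] Q2P x /PQ'].
    by apply: Q'min => // y /Q2P/PQ'.
  exists Q'; [by right | move=> Q2 [<-|]]; [by [] | exact: Q'min].
exists Q; split=> [|Q' IQ' Q'Q]; first exact: lI.
have [Q2 Q2l Q2Q'] := lmin _ IQ'.
have Q2Q : {subset Q2 <= Q} by move=> x /Q2Q'/Q'Q.
by move=> x /(Qmin _ Q2l Q2Q)/Q2Q'.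
Qed.

Lemma prime_avoidance (l : seq (prime_idealr S)) b c :
    (forall P, List.In P l -> b \notin P) ->
  exists a, forall P, List.In P l -> c + b * a \notin P.
Proof.
elim: l => [|P l IHl] bl; first by exists 0.
have [Q Ql|a al] := IHl; first by apply: bl; right.
have bP : b \notin P by apply: bl; left.
have [caP|caP] := boolP (c + b * a \in P); last first.
  by exists a => Q [<-//|]; exact: al.
(* Adding [d] to [a] moves the element out of [P], hence out of every [Q] inside [P], and does not
   change it modulo the other [Q]. *)
have [d dP dl] : exists2 d, d \notin P &
    forall Q, List.In Q l -> d \in Q \/ {subset Q <= P}.
  elim: l {IHl bl al} => [|Q l [d dP dl]].
    by exists 1 => //; rewrite idealr1.
  have [QP|/existsNP[e /not_implyP[eQ /negP eP]]] := pselect {subset Q <= P}.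
    by exists d => // Q' [<-|]; [right | exact: dl].
  exists (d * e); first exact: notin_mulr.
  move=> Q' [<-|/dl[dQ'|]]; [left; exact: idealMr | left | by right].
  by rewrite mulrC idealMr.
have cadP : c + b * (a + d) \notin P.
  by rewrite mulrDr addrA (rpredDl _ caP) notin_mulr.
exists (a + d) => Q [<-//|Ql]; have [dQ|QP] := dl Q Ql; last first.
  by apply: contra cadP; exact: QP.
by rewrite mulrDr addrA rpredDr ?idealMr // al.
Qed.

(** * Chains of primes and generic elements *)

(** Strict chains of [k] steps below [P] whose smallest prime contains [A]. In Krull's height
    theorem the generators are moved into [A] one at a time. *)
Fixpoint chain_over A P k : Prop :=
  if k is k'.+1 then exists Q, [set` Q] `<` [set` P] /\ chain_over A Q k'
  else A `<=` [set` P].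

Lemma chain_over_base A P k : chain_over A P k -> A `<=` [set` P].
Proof.
by elim: k P => [//|k IHk] P [Q [[QP _] /IHk AQ]] x /AQ/QP.
Qed.

Lemma prime_chain_over P k : prime_chain P k <-> chain_over set0 P k.
Proof.
split.
  elim: k P => [|k IHk] P [p [pmono pP]]; first exact: sub0set.
  exists (p (widen_ord (leqnSn _) ord_max)); split.
    by rewrite -pP; apply: pmono => /=.
  apply: IHk; exists (fun j => p (widen_ord (leqnSn _) j)); split=> // i j ij.
  exact: pmono.
elim: k P => [|k IHk] P /=.
  by exists (fun=> P); split=> // i j; rewrite !ord1.
move=> [Q [QP /IHk[p [pmono pQ]]]].
exists (fun i : 'I_k.+2 => if (i < k.+1)%N then p (inord i) else P).
split; last by rewrite ltnn.
move=> i j ij; have [jk|kj] := ltnP j k.+1.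
  by rewrite (ltn_trans ij jk); apply: pmono; rewrite !inordK // (ltn_trans ij).
have -> : (i < k.+1)%N by rewrite -ltnS (leq_trans _ (ltn_ord j)).
have [ik|ik] := ltnP i k.
  have [iQ _] : [set` p (inord i)] `<` [set` Q].
    by rewrite -pQ; apply: pmono; rewrite inordK // ltnS ltnW.
  by have [QP' nPQ] := QP; split=> [x /iQ/QP' //|Pi]; apply: nPQ => x /Pi/iQ.
suff -> : inord i = ord_max :> 'I_k.+1 by rewrite pQ.
apply: val_inj => /=; rewrite inordK.
  by apply/eqP; rewrite eqn_leq ik -ltnS (leq_trans ij) // -ltnS ltn_ord.
by rewrite (leq_trans ij) // -ltnS ltn_ord.
Qed.

(** If [P] contains the first [k + 1] elements but not [b], it contains a prime [Q] from a finite
    list of primes over the first [k]. As [Q] misses [b], it also misses the next element by the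
    choice of its coefficient, so [Q] is strictly below [P]. *)
Lemma generic_chain_over (g : nat -> S) b k : exists c : nat -> S, forall P,
  (forall i, (i < k)%N -> g i + b * c i \in P) -> b \notin P ->
  chain_over set0 P k.
Proof.
elim: k => [|k [c ck]]; first by exists (fun=> 0) => P _ _ /=; exact: sub0set.
(* [K] is the intersection of the primes containing the first [k] elements. *)
have [|x y xK yK P h|a x xK P h|K KP] := @ideal_of_set S
    (fun x => forall P, (forall i, (i < k)%N -> g i + b * c i \in P) ->
      x \in P).
- by move=> P _; exact: rpred0.
- by rewrite rpredD ?xK ?yK.
- by rewrite idealMr ?xK.
have [l [lK lmin]] := primes_over K.
have [l' l'P] : exists l', forall P, List.In P l' <-> List.In P l /\ b \notin P.
  exists (List.filter (fun P : prime_idealr S => b \notin P) l) => P.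
  exact: List.filter_In.
have [P /l'P[]//|a al] := @prime_avoidance l' b (g k).
exists (fun i => if i == k then a else c i) => P gP bP.
have KinP : {subset K <= P}.
  move=> x /KP; apply=> i ik.
  by have := gP i (ltnW ik); rewrite ltn_eqF.
have [Q Ql QP] := lmin P KinP.
have bQ : b \notin Q by apply: contra bP; exact: QP.
exists Q; split; last first.
  apply: ck => // i ik; apply: (lK Q Ql).
  by apply/KP => P'; exact.
split=> // PQ; have /al/negP : List.In Q l' by exact/l'P.
by apply; apply: PQ; have := gP k (ltnSn k); rewrite eqxx.
Qed.

(** * Localization at a prime and Krull's height theorem *)

(* This is [a/1 \in I_P]; the localization at [P] itself is never formed. *)
Definition locally_in P I a : Prop := exists2 s, s \notin P & s * a \in I.

Lemma locally_in_mull P I a b : locally_in P I a -> locally_in P I (b * a).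
Proof. by case=> s sP saI; exists s => //; rewrite mulrCA ideal_mull. Qed.

Lemma colon_ideal P K a : exists I, forall x,
  x \in I <-> locally_in P K (x * a).
Proof.
apply: ideal_of_set => [|x y [s sP sxK] [t tP tyK]|b x xK].
- by exists 1; rewrite ?idealr1 // mul0r mulr0 rpred0.
- exists (s * t); first exact: notin_mulr.
  rewrite mulrDl mulrDr rpredD //; last by rewrite -mulrA ideal_mull.
  by rewrite mulrAC mulrC ideal_mull.
- by rewrite -mulrA; exact: locally_in_mull.
Qed.

(* An element of the socle of the local Artinian ring [(S/K)_P]. *)
Lemma locally_socle P K :
    (forall y, y \in P -> exists k, locally_in P K (y ^+ k)) ->
    ~ locally_in P K 1 ->
  exists2 a, ~ locally_in P K a & forall y, y \in P -> locally_in P K (y * a).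
Proof.
move=> nilP nK1.
(* [a] is chosen with maximal annihilator among the nonzero elements of [(S/K)_P]. *)
have [|I [a [aK IP]] Imax] := maxS (F := [set I : ideal S | exists a,
    ~ locally_in P K a /\ forall x, x \in I <-> locally_in P K (x * a)]).
  by have [I IP] := colon_ideal P K 1; exists I, 1.
exists a => // y yP; apply: contrapT => yaK.
(* By maximality a nonzero [y ^ k * a] has the annihilator of [a], so [y] does not kill it either.
   Hence no power of [y] kills [a], against nilpotency. *)
have yka k : ~ locally_in P K (y ^+ k * a).
  elim: k => [|k IHk]; first by rewrite expr0 mul1r.
  have [J JP] := colon_ideal P K (y ^+ k * a).
  have /Imax : [set I : ideal S | exists a, ~ locally_in P K a /\
      forall x, x \in I <-> locally_in P K (x * a)] J by exists (y ^+ k * a).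
  move=> JI yk; apply/yaK/IP/JI.
    by move=> x /IP xa; apply/JP; rewrite mulrCA; exact: locally_in_mull.
  by apply/JP; rewrite mulrA -exprS.
have [k ykK] := nilP y yP.
by apply: (yka k); rewrite mulrC; exact: locally_in_mull.
Qed.

(* The local ring [(S/K)_P] is Artinian. *)
Lemma locally_dcc P K :
    (forall y, y \in P -> exists k, locally_in P K (y ^+ k)) ->
  forall N : nat -> ideal S, (forall k, {subset K <= N k}) ->
    (forall k l, (k <= l)%N -> {subset N l <= N k}) ->
  exists k0, forall k, (k0 <= k)%N -> forall a, a \in N k0 ->
    locally_in P (N k) a.
Proof.
elim/noetherian_ind: K => K IHK nilP N KN Nmono.
have [[s sP]|nK1] := pselect (locally_in P K 1).
  rewrite mulr1 => sK; exists 0%N => k _ a _; exists s => //.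
  by rewrite mulrC ideal_mull // KN.
have [a aK Pa] := locally_socle nilP nK1.
have /choice[N' N'P] k := ideal_add_principal (N k) a.
have [K' [KK' aK' K'P]] := ideal_add_principal K a.
have N'E k x : x \in N' k <-> exists2 y, y \in N k & exists t, x = y + t * a.
  by case: (N'P k).
have NN' k : {subset N k <= N' k} by case: (N'P k).
(* The induction hypothesis is applied to [K + (a)] and the ideals [N k + (a)]. *)
have [|y /nilP[k [s sP sK]]|k x /K'P[y yK yt]|k l kl x /N'E[y yN xt]|k1 N'st] :=
    IHK K' KK' _ _ N'.
- by move=> /(_ _ aK') aK2; apply: aK; exists 1; rewrite ?idealr1 // mul1r.
- by exists k, s => //; exact: KK'.
- by apply/N'E; exists y => //; exact: KN.
- by apply/N'E; exists y => //; exact: Nmono yN.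
(* If [a] lies locally in all [N k], adjoining it changes nothing locally. Otherwise, from [k2] on,
   the coefficient [t] of [a] must lie in [P], and then [t * a] is locally in [K]. *)
have [aN|/existsNP[k2 aN]] := pselect (forall k, locally_in P (N k) a).
  exists k1 => k k1k x /NN'/(N'st k k1k)[s sP /N'E[y yN [t sxE]]].
  have [s' s'P s'a] := aN k; exists (s' * s); first exact: notin_mulr.
  by rewrite -mulrA sxE mulrDr rpredD //; [|rewrite mulrCA];
    exact: ideal_mull.
exists (maxn k1 k2) => k; rewrite geq_max => /andP[k1k k2k] x xN.
have /NN'/(N'st k k1k)[s sP /N'E[y yN [t sxE]]] : x \in N k1.
  by apply: Nmono xN; exact: leq_maxl.
have [tP|tP] := boolP (t \in P); last first.
  case: aN; exists t => //; apply: (Nmono _ _ (leq_maxr k1 k2)).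
  have -> : t * a = s * x - y by rewrite sxE addrC addKr.
  rewrite rpredB ?ideal_mull //; apply: Nmono yN.
  by rewrite geq_max k1k.
have [s' s'P s'a] := Pa t tP; exists (s' * s); first exact: notin_mulr.
by rewrite -mulrA sxE mulrDr rpredD //; [exact: ideal_mull | exact: KN].
Qed.

(** Let [N'] be maximal among the ideals over [N] that do not contain [M] locally, and [g] in [M] be
    not locally in [N']. Then [M] is locally in [N' + (g)], and substituting this in the relation
    for [g] puts a multiple of [g] by an element outside [P] into [N']. *)
Lemma locally_nakayama P M N x : x \in P ->
    (forall a, a \in M -> exists2 s, s \notin P &
       exists2 b, b \in N & exists2 t, t \in M & s * a = b + x * t) ->
  forall a, a \in M -> locally_in P N a.
Proof.
move=> xP MNx; apply: contrapT => nMN.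
have [|N' [NN' nMN'] N'max] := maxS (F := [set N' : ideal S |
    {subset N <= N'} /\ ~ forall a, a \in M -> locally_in P N' a]).
  by exists N; split.
apply: nMN' => g gM; apply: contrapT => gN'.
have [N2 [N'N2 gN2 N2P]] := ideal_add_principal N' g.
have MN2 a : a \in M -> locally_in P N2 a.
  move: a; apply: contrapT => nMN2; apply: gN'; exists 1; rewrite ?idealr1 //.
  by rewrite mul1r; apply: (N'max N2) => //; split=> // y /NN'/N'N2.
have [s sP [b bN [t tM sgE]]] := MNx g gM.
have [s' s'P /N2P[c cN' [u s'tE]]] := MN2 t tM.
apply: gN'; exists (s' * s - x * u).
  by rewrite rpredBr ?notin_mulr // mulrC idealMr.
have -> : (s' * s - x * u) * g = s' * b + x * c.
  rewrite mulrBl -mulrA sgE mulrDr mulrCA s'tE mulrDr -!mulrA.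
  by rewrite addrA addrK.
by rewrite rpredD // ideal_mull // NN'.
Qed.

(* Krull's principal ideal theorem for the domain [S/Q0]. With [y] in
   [Q1 \ Q0], it follows from the stationarity modulo [x] of the ideals
   [y ^ k (S/Q0)_Q1], in the place of the symbolic powers of [Q1]. *)
Lemma krull_principal Q0 Q1 P x :
    [set` Q0] `<` [set` Q1] -> [set` Q1] `<` [set` P] -> x \in P ->
  exists Q, [/\ {subset Q0 <= Q}, x \in Q & [set` Q] `<` [set` P]].
Proof.
move=> [Q01 nQ10] [Q1P nPQ1] xP; apply: contrapT => nQ.
(* If the claim fails, [P] is minimal over [Q0 + (x)]. *)
have {nQ}Pmin Q : {subset Q0 <= Q} -> x \in Q -> {subset Q <= P} ->
    {subset P <= Q}.
  by move=> Q0Q xQ QP; apply: contrapT => nPQ; apply: nQ; exists Q.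
have xQ1 : x \notin Q1 by apply/negP => /(Pmin Q1 Q01)/(_ Q1P).
have [y yQ1 yQ0] : exists2 y, y \in Q1 & y \notin Q0.
  apply: contrapT => ny; apply: nQ10 => y yQ1 /=.
  by apply: contrapT => /negP yQ0; apply: ny; exists y.
have [I0 I0Q0] := ideal_of_prime Q0.
have [K [I0K xK KP]] := ideal_add_principal I0 x.
(* By minimality of [P], its elements are nilpotent in [(S/K)_P]: otherwise a prime over [K]
   avoiding all [s * z ^ k] would lie strictly inside [P]. *)
have nilP z : z \in P -> exists k, locally_in P K (z ^+ k).
  move=> zP; apply: contrapT => nz.
  have [||u uK [s sP [k uE]]|Q [KQ QM]] := @prime_disjoint K
      [set u | exists2 s, s \notin P & exists k, u = s * z ^+ k].
  - by exists 1; [rewrite idealr1 | exists 0%N; rewrite mul1r].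
  - move=> _ _ [s sP [k ->]] [t tP [l ->]].
    exists (s * t); first exact: notin_mulr.
    by exists (k + l)%N; rewrite mulrACA exprD.
  - by apply: nz; exists k, s; rewrite -?uE.
  have QP : {subset Q <= P}.
    move=> t tQ; apply: contrapT => /negP tP; apply: (QM t tQ).
    by exists t => //; exists 0%N; rewrite mulr1.
  have zQ : z \in Q.
    by apply: Pmin zP => // [u uQ0|]; apply: KQ => //; apply: I0K; rewrite I0Q0.
  apply: (QM z zQ); exists 1; first by rewrite idealr1.
  by exists 1%N; rewrite mul1r.
have /choice[L LP] (k : nat) : exists I, forall a, a \in I <->
    exists2 s, s \notin Q1 & exists t, s * a - t * y ^+ k \in Q0.
  apply: ideal_of_set.
  - exists 1; rewrite ?idealr1 //; exists 0.
    by rewrite mulr0 mul0r subrr rpred0.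
  - move=> a b [s sQ1 [t sa]] [s' s'Q1 [t' s'b]].
    exists (s * s'); first exact: notin_mulr.
    exists (s' * t + s * t').
    have -> : s * s' * (a + b) - (s' * t + s * t') * y ^+ k =
        s' * (s * a - t * y ^+ k) + s * (s' * b - t' * y ^+ k).
      by rewrite !mulrBr mulrDl opprD mulrDr addrACA !mulrA (mulrC s s').
    by rewrite rpredD // idealMr.
  - move=> b a [s sQ1 [t sa]]; exists s => //; exists (b * t).
    by rewrite mulrCA -mulrA -mulrBr idealMr.
have Q0L k : {subset Q0 <= L k}.
  move=> a aQ0; apply/LP; exists 1; rewrite ?idealr1 //; exists 0.
  by rewrite mul1r mul0r subr0.
have LS k l : (k <= l)%N -> {subset L l <= L k}.
  move=> /subnK <- a /LP[s sQ1 [t sa]]; apply/LP; exists s => //.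
  by exists (t * y ^+ (l - k)); rewrite -mulrA -exprD.
have /choice[N NP] k := ideal_add_principal (L k) x.
have NE k a : a \in N k <-> exists2 b, b \in L k & exists t, a = b + t * x.
  by case: (NP k).
have [|k l kl a|k Nk] := locally_dcc nilP (N := N).
- move=> k a /KP[u uI0 ta]; apply/NE; exists u => //.
  by apply: Q0L; rewrite -I0Q0.
- by move=> /NE[u uL ta]; apply/NE; exists u => //; exact: LS uL.
have ykL : y ^+ k \in L k.
  apply/LP; exists 1; rewrite ?idealr1 //; exists 1.
  by rewrite subrr rpred0.
have [|s sP /LP[s' s'Q1 [t syE]]] := locally_nakayama (N := L k.+1) xP _ ykL.
  move=> a aL; have [|s sP /NE[b bL [t saE]]] := Nk _ (leqnSn k) a.
    by case: (NP k) => LN _ _; exact: LN.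
  exists s => //; exists b => //; exists t; last by rewrite saE (mulrC x).
  (* As [x] is outside [Q1], having [t * x] in [L k] forces [t] into [L k]; so, locally at [P],
     [L k] lies in [L k.+1 + x L k]. *)
  have /LP[s' s'Q1 [u]] : t * x \in L k.
    have -> : t * x = s * a - b by rewrite saE addrC addKr.
    by rewrite rpredB ?ideal_mull // (LS _ _ (leqnSn k) b).
  rewrite mulrCA [t * _]mulrC => tx; apply/LP.
  by exists (s' * x); [exact: notin_mulr | exists u].
have sQ1 : s \notin Q1 by apply: contra sP; exact: Q1P.
(* Cancelling [y ^ k], nonzero in the domain [S/Q0], makes a product of elements outside [Q1] a
   multiple of [y] modulo [Q0], although [y] lies in [Q1]. *)
have : (s' * s - t * y) * y ^+ k \in Q0 by rewrite mulrBl -!mulrA -exprS.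
rewrite prime_idealrM (negPf (notin_expr _ yQ0)) orbF => /Q01 /=.
by apply/negP; rewrite rpredBr ?notin_mulr // idealMr.
Qed.

(** From the top down, a prime [Q1] missing [x] is replaced, by [krull_principal], by one that
    contains [x] and lies strictly between its neighbours. The bottom prime is given up, which costs
    one step. *)
Lemma chain_over_drop A P k x : chain_over A P k.+1 -> x \in P ->
  chain_over (x |` A) P k.
Proof.
elim: k P => [|k IHk] P [Q1 [Q1P ch]] xP.
  by move=> y [->//|/ch]; exact: Q1P.1.
have [xQ1|xQ1] := boolP (x \in Q1).
  by exists Q1; split=> //; exact: IHk.
have [Q0 [Q01 Q0k]] := ch.
have [Q [Q0Q xQ QP]] := krull_principal Q01 Q1P xP.
exists Q; split=> //; apply: IHk => //; exists Q0; split=> //.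
by split=> // QQ0; move/negP: xQ1; apply; apply/Q01.1/QQ0.
Qed.

Lemma chain_over_drops (s : seq S) A P k : {subset s <= P} ->
  chain_over A P (size s + k) -> chain_over ([set` s] `|` A) P k.
Proof.
elim: s A => [|x s IHs] A sP.
  suff -> : [set` [::]] `|` A = A by [].
  by apply/seteqP; split=> y //=; [case | right].
rewrite addSn => /chain_over_drop/(_ (sP x (mem_head _ _)))/IHs.
have -> : [set` (x :: s)] `|` A = [set` s] `|` (x |` A).
  apply/seteqP; split=> y /=; rewrite in_cons.
    by move=> [/predU1P[->|ys]|Ay]; [right; left | left | right; right].
  by move=> [->|[->|Ay]]; [rewrite orbT; left | rewrite eqxx; left | right].
by apply=> y ys; apply: sP; rewrite inE ys orbT.
Qed.

(* Krull's height theorem. *)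
Lemma height_generated I k (g : 'I_k -> S) : 1 \notin I ->
    [set` I] = spanned (g : 'I_k -> S^o) ->
    (forall P, {subset I <= P} -> chain_over set0 P k) ->
  height I k.
Proof.
move=> I1 Ig Ich; split; last by move=> P IP; apply/prime_chain_over/Ich.
have [P [IP Pmin]] := minimal_prime_over I1.
exists P; split=> //; split; first exact/prime_chain_over/Ich.
move=> l /prime_chain_over Pl; rewrite leqNgt; apply/negP => kl.
have gI i : g i \in I.
  have : [set` I] (g i); last by [].
  by rewrite Ig; exact: (@mem_spanned _ S^o).
pose s := [seq g i | i : 'I_k].
have sP : {subset s <= P} by move=> _ /mapP[i _ ->]; exact/IP/gI.
have ss : size s = k by rewrite size_map size_enum_ord.
(* Since [l > k], at least one step is left after [k] drops: a prime strictly below [P] containing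
   all generators, against minimality. *)
have {}Pl : chain_over set0 P (size s + (l - k.+1).+1).
  by rewrite ss addnS -addSn subnKC.
have [Q [[QP nPQ] /chain_over_base sQ]] := chain_over_drops sP Pl.
apply/nPQ/Pmin => // x xI; have : [set` I] x by [].
rewrite Ig => -[c _ <-]; apply: rpred_sum => i _; apply: idealMr.
by apply: sQ; left; apply/mapP; exists i; rewrite ?mem_enum.
Qed.
End NoetherianPrimes.

(** * Evaluation of polynomials and the homotopy to the unit ideal *)

Lemma prime_preimage (S R : comNzRingType) (phi : {rmorphism S -> R})
    (P : prime_idealr R) :
  exists Q : prime_idealr S, forall x, (x \in Q) = (phi x \in P).
Proof.
have [|x y xP yP|a x xP|I IP] := @ideal_of_set S (fun x => phi x \in P).
- by rewrite rmorph0 rpred0.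
- by rewrite rmorphD rpredD.
- by rewrite rmorphM idealMr.
have [|x y /IP|Q QI] := @prime_of_ideal S I.
- by apply/negP => /IP; rewrite rmorph1 idealr1.
- by rewrite rmorphM prime_idealrM => /orP[] ?; [left | right]; exact/IP.
by exists Q => x; rewrite QI; apply/idP/idP => /IP.
Qed.

Lemma span_ideal (S : comNzRingType) k (g : 'I_k -> S) :
  exists I : ideal S, [set` I] = spanned (g : 'I_k -> S^o).
Proof.
have [|x y [c _ <-] [d _ <-]|a x [c _ <-]|I IP] :=
    @ideal_of_set S (spanned (g : 'I_k -> S^o)).
- by exists (fun=> 0) => //; rewrite big1 // => i _; rewrite scale0r.
- exists (fun i => c i + d i) => //.
  by rewrite -big_split /=; apply: eq_bigr => i _; rewrite scalerDl.
- exists (fun i => a * c i) => //.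
  by rewrite mulr_sumr; apply: eq_bigr => i _; exact/esym/mulrA.
by exists I; apply/seteqP; split=> x /IP.
Qed.

Lemma mem_ideal_at (R : comNzRingType) (I : ideal {poly R}) a x :
  x \in ideal_at I a <-> exists2 p, p \in I & p.[a] = x.
Proof. by split=> /asboolP. Qed.

Lemma ideal_at_spanned (R : comNzRingType) (I : ideal {poly R}) k
    (F : 'I_k -> {poly R}) a : [set` I] = spanned (F : 'I_k -> {poly R}^o) ->
  [set` ideal_at I a] = spanned (fun i => (F i).[a] : R^o).
Proof.
move=> IF; apply/seteqP; split=> x.
  move=> /mem_ideal_at[p pI <-]; have : [set` I] p by [].
  rewrite IF => -[c _ <-]; exists (fun i => (c i).[a]) => //.
  by rewrite horner_sum; apply: eq_bigr => i _; rewrite hornerM.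
move=> [c _ <-]; apply/mem_ideal_at; exists (\sum_i (c i)%:P * F i).
  by have : [set` I] (\sum_i (c i)%:P * F i) by rewrite IF; exists (polyC \o c).
by rewrite horner_sum; apply: eq_bigr => i _; rewrite hornerCM.
Qed.

Lemma poly_factorX (R : comNzRingType) (p : {poly R}) :
  exists q, p = p.[0]%:P + 'X * q.
Proof.
have /factor_theorem[q pE] : root (p - p.[0]%:P) 0.
  by rewrite /root hornerD hornerN hornerC subrr.
by exists q; rewrite mulrC -[X in q * X]subr0 -polyC0 -pE addrC subrK.
Qed.

(** Preimages of primes under evaluation at 0 keep strict inclusions, because constants separate
    them. *)
Lemma chain_over_horner0 (R : comNzRingType) (Q : prime_idealr R)
    (P : prime_idealr {poly R}) k :
    (forall p, (p \in P) = (p.[0] \in Q)) ->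
  chain_over set0 Q k -> chain_over set0 P k.
Proof.
elim: k P Q => [|k IHk] P Q PQ; first by move=> _; exact: sub0set.
move=> [Q' [[Q'Q nQQ'] ch]].
have [P' P'Q'] := prime_preimage (horner_eval 0) Q'.
exists P'; split; last exact: IHk P'Q' ch.
split=> [p|PP']; first by rewrite /= P'Q' PQ => /Q'Q.
apply: nQQ' => a aQ; have : a%:P \in P' by apply: PP'; rewrite /= PQ hornerC.
by rewrite P'Q' /= /horner_eval hornerC.
Qed.

(* The coefficients [c i] are generic. Then a prime [P] containing all the [F i]
   has height at least [n]: if ['X] and [1 - 'X] are not in [P], by genericity;
   if ['X] is in [P], because [P] contracts to a prime containing [J]; and
   [1 - 'X] is not in [P] since [F 0] is [1] modulo [1 - 'X]. *)
Lemma homotopy_to_unit (R : comNzRingType) (n : nat) (J : ideal R)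
    (f : 'I_n -> R) : noetherian R -> (0 < n)%N -> height J n ->
    [set` J] = spanned (f : 'I_n -> R^o) ->
  exists (I : ideal {poly R}) (F : 'I_n -> {poly R}),
  [/\ height I n, [set` I] = spanned (F : 'I_n -> {poly R}^o),
      forall i, (F i).[0] = f i & exists i, (F i).[1] = 1].
Proof.
move=> noeR n_gt0 [[P0 [JP0 _]] Jht] Jf.
have maxRT := max_principle_poly (noetherian_max_principle noeR).
(* The term added for [i = 0] vanishes at 0 and turns the value at 1 into 1. *)
pose h (i : 'I_n) := (f i)%:P + ((i : nat) == 0%N)%:R * 'X * (1 - (f i)%:P).
(* [generic_chain_over] takes families indexed by [nat]; the default 0 fills the indices from [n]
   on. *)
have [c cP] := generic_chain_over maxRT (fun k => oapp h 0 (insub k))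
  ('X * (1 - 'X)) n.
pose F i := h i + 'X * (1 - 'X) * c i.
have F0 i : (F i).[0] = f i.
  by rewrite /F /h !hornerE.
have F1 : (F (Ordinal n_gt0)).[1] = 1.
  rewrite /F /h eqxx !hornerE subrr mul0r addr0 /=.
  by rewrite addrAC subrr add0r.
have [I IF] := span_ideal F.
have I0 := ideal_at_spanned 0 IF.
have J0 : [set` ideal_at I 0] = [set` J].
  by rewrite I0 Jf (_ : (fun i => (F i).[0]) = f) //; apply/funext => i.
exists I, F; split=> //; last by exists (Ordinal n_gt0).
apply: (height_generated maxRT _ IF).
  apply/negP => I1; have /JP0 : [set` J] 1.
    by rewrite -J0; apply/mem_ideal_at; exists 1; rewrite ?hornerC.
  by rewrite /= idealr1.
move=> P IP.
have FP i : F i \in P.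
  by apply: IP; have := @mem_spanned _ {poly R}^o n F i; rewrite -IF.
have [XP|XP] := boolP ('X \in P).
  have [Q QP] := prime_preimage (@polyC R) P.
  (* Modulo ['X] a polynomial is its constant term, so [P] is the preimage of its contraction [Q]
     under evaluation at 0. *)
  have PQ p : (p \in P) = (p.[0] \in Q).
    have [q {1}->] := poly_factorX p.
    by rewrite rpredDr ?QP // mulrC idealMr.
  apply: (chain_over_horner0 PQ); apply/prime_chain_over/Jht => x.
  rewrite -J0 => /mem_ideal_at[p pI <-].
  by rewrite /= -PQ IP.
have [X1P|X1P] := boolP (1 - 'X \in P).
  have := idealr1 P; suff -> : 1 \in P by [].
  have /factor_theorem[q qE] : root (F (Ordinal n_gt0) - 1) 1.
    by rewrite /root hornerD hornerN hornerC F1 subrr.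
  rewrite -(rpredBr _ (FP (Ordinal n_gt0))) -rpredN opprB qE polyC1.
  by rewrite -opprB mulrN rpredN idealMr.
apply: cP => [i ik|]; last exact: notin_mulr.
by rewrite (insubT (fun k => k < n)%N ik); exact: FP.
Qed.

(** * Surjections onto conormal modules and their cycles *)

#[local] Arguments conormal {R} J _.

Section Classes.
Variable R : comNzRingType.
Implicit Types I J : ideal R.

Lemma cls0 I : cls I 0 = 0.
Proof. exact: (raddf0 (\pi_{ideal_quot I})%qT). Qed.

Lemma cls_lin I k (c x : 'I_k -> R) :
  \sum_i c i *: cls I (x i) = cls I (\sum_i c i * x i).
Proof.
rewrite (big_morph _ (@clsD R I) (cls0 I)); apply: eq_bigr => i _.
exact: modq_scaleE.
Qed.

Lemma mem_ideal_sq I x y : x \in I -> y \in I -> x * y \in ideal_sq I.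
Proof.
by move=> xI yI; apply/asboolP => K; apply; exists x => //; exists y.
Qed.

Lemma ideal_sq_sub I J : {subset I <= J} ->
  {subset ideal_sq I <= ideal_sq J}.
Proof.
move=> IJ x /asboolP; apply=> _ [y yI [z zI <-]].
by apply: (@mem_ideal_sq J); exact: IJ.
Qed.

Lemma conormal_cls I x : x \in I -> conormal I (cls (ideal_sq I) x).
Proof. by move=> xI; exists x. Qed.

End Classes.

Section Symbols.
Variables (R : comNzRingType) (n : nat).
Implicit Types J : ideal R.

Definition basisv (i : 'I_n) : {ffun 'I_n -> R^o} := [ffun j => (j == i)%:R].

(** Here [J/J^2] is zero, so the zero map is a surjection, and it is induced by any family. *)
Lemma surjection_unit J : unit_ideal J ->
  exists w : surjection n J, forall f, induced_by w f.
Proof.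
move=> J1; have all0 x : cls (ideal_sq J) x = 0.
  rewrite -cls0; apply/cls_eq; rewrite subr0 -[x]mulr1.
  have JT y : y \in J by have : [set` J] y by rewrite J1.
  exact: mem_ideal_sq.
have w0 : range (\0 : {ffun 'I_n -> modq J} -> modq (ideal_sq J)) = conormal J.
  apply/seteqP; split=> [_ [v _ <-]|_ [x _ <-]].
    by exists 0; [exact: rpred0 | rewrite all0].
  by exists 0; rewrite ?all0.
by exists (Surjection w0) => f i; rewrite all0.
Qed.

(** A component of a decomposition would contain the unit ideal, but primary ideals are proper; so
    the decomposition is empty. *)
Lemma cycle_of_unit J (w : surjection n J) g : unit_ideal J ->
  cycle_of w g <-> g = 0.
Proof.
move=> J1; split=> [[[|r] [s [[JE sprim _ _] _ ->]]]|->].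
- by rewrite big_ord0.
- case: (sprim ord0) => nunit _; case: nunit.
  apply/seteqP; split=> // x _; have : [set` J] x by rewrite J1.
  by rewrite JE; exact.
have [s] : inhabited ('I_0 -> symbol R n) by constructor; case.
exists 0%N, s; split; [split | by case | by rewrite big_ord0].
- by rewrite J1; apply/seteqP; split=> // x _ [].
- by case.
- by case.
- by case.
Qed.

Lemma ffun_basis (v : {ffun 'I_n -> R^o}) : v = \sum_i v i *: basisv i.
Proof.
apply/ffunP => j; rewrite sum_ffunE (bigD1 j) //= !ffunE eqxx.
rewrite big1 ?addr0; first exact/esym/mulr1.
by move=> i /negPf ij; rewrite !ffunE eq_sym ij; exact: mulr0.
Qed.

Lemma linear_basis (M : lmodType R) (u : {linear {ffun 'I_n -> R^o} -> M}) v :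
  u v = \sum_i v i *: u (basisv i).
Proof.
by rewrite {1}[v]ffun_basis linear_sum; apply: eq_bigr => i _; rewrite linearZ.
Qed.

Lemma clsv_basis J (v : {ffun 'I_n -> R^o}) :
  clsv J v = \sum_i (v i : R) *: clsv J (basisv i).
Proof.
apply/ffunP => j; rewrite sum_ffunE /clsv ffunE.
rewrite {1}[v]ffun_basis sum_ffunE (big_morph _ (@clsD R J) (cls0 J)).
by apply: eq_bigr => i _; rewrite !ffunE; exact/esym/modq_scaleE.
Qed.

Lemma surjection_induced_by J (w : surjection n J) f v : induced_by w f ->
  w (clsv J v) = cls (ideal_sq J) (\sum_i v i * f i).
Proof.
move=> wf; rewrite clsv_basis linear_sum -cls_lin; apply: eq_bigr => i _.
by rewrite linearZ wf.
Qed.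

Lemma lifts_spanned J (w : surjection n J) f : induced_by w f ->
  [set` J] = spanned (f : 'I_n -> R^o) -> lifts w.
Proof.
move=> wf Jf; pose u (v : {ffun 'I_n -> R^o}) : R^o := \sum_i v i * f i.
have ulin : linear u.
  move=> a x y; rewrite /u scaler_sumr -big_split; apply: eq_bigr => i _ /=.
  by rewrite !ffunE mulrDl; congr (_ + _); exact/esym/mulrA.
pose theta : {linear {ffun 'I_n -> R^o} -> R^o} :=
  HB.pack u (GRing.isLinear.Build R {ffun 'I_n -> R^o} R^o *:%R u ulin).
exists theta; split=> [|v]; last by rewrite (surjection_induced_by v wf).
rewrite Jf; apply/seteqP; split=> [_ [v _ <-]|_ [c _ <-]].
  by exists v.
by exists [ffun i => c i] => //=; apply: eq_bigr => i _; rewrite ffunE.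
Qed.

(** Minimality is inherited from one component [q]: generators of [J/J^2] map to generators of
    [q/q^2], for which at least [n] are needed by the definition of a symbol. *)
Lemma mu_conormal J (w : surjection n J) f r (s : 'I_r.+1 -> symbol R n) :
    induced_by w f -> [set` J] = spanned (f : 'I_n -> R^o) ->
    (forall i, {subset J <= sym_ideal (s i)}) ->
    (forall i, induces w (sym_surj (s i))) ->
  mu (conormal J) n.
Proof.
move=> wf Jf Js ws; split.
  exists (fun i => cls (ideal_sq J) (f i)); apply/seteqP; split.
    move=> _ [c _ <-]; rewrite cls_lin; apply: conormal_cls.
    by have : [set` J] (\sum_i c i * f i) by rewrite Jf; exists c.
  move=> _ [x xJ <-]; move: xJ; rewrite Jf => -[c _ <-].
  by exists c => //; rewrite cls_lin.
move=> l g gJ.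
have /choice[x xP] (i : 'I_l) : exists x, x \in J /\ cls (ideal_sq J) x = g i.
  have : conormal J (g i) by rewrite -gJ; exact: mem_spanned.
  by case=> x xJ <-; exists x.
set q := sym_ideal (s ord0); set wq := sym_surj (s ord0).
apply: (sym_mu (s ord0)).2 (fun i => cls (ideal_sq q) (x i)) _.
apply/seteqP; split=> [_ [c _ <-]|_ [y yq <-]].
  rewrite cls_lin; apply: conormal_cls; apply: rpred_sum => i _.
  by apply: ideal_mull; apply: Js; exact: (xP i).1.
(* A preimage of the class of [y] under [wq] is lifted to [R] and sent through [w]; so that class
   comes from some [z] in [J]. *)
have : conormal q (cls (ideal_sq q) y) by exact: conormal_cls.
rewrite -(surj_range wq) => -[u _ uy].
pose v : {ffun 'I_n -> R^o} := [ffun i => cls_repr (u i)].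
have uv : u = clsv q v by apply/ffunP => i; rewrite !ffunE cls_reprK.
have : conormal J (w (clsv J v)) by rewrite -(surj_range w); exists (clsv J v).
move=> [z zJ zw]; have := ws ord0 v z zJ (esym zw); rewrite -/wq -uv uy => ->.
have : conormal J (cls (ideal_sq J) z) by exact: conormal_cls.
rewrite -gJ => -[c _]; under eq_bigr => i _ do rewrite -(xP i).2.
rewrite cls_lin => /cls_eq zc; exists c => //; rewrite cls_lin.
by apply/cls_eq; apply: ideal_sq_sub zc; exact: Js.
Qed.

(** Membership in [lifted_cycles] requires [mu (conormal J) n], which any component provides;
    without components the cycle is 0. *)
Lemma lifted_cycles_endpoint J (w : surjection n J) f g : induced_by w f ->
    [set` J] = spanned (f : 'I_n -> R^o) -> height_or_unit n J ->
    cycle_of w g ->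
  g \in subgroup_gen (@lifted_cycles R n).
Proof.
move=> wf Jf [Jht|J1] wg; last first.
  by rewrite ((cycle_of_unit w g J1).1 wg) rpred0.
have [r [s [[JE sprim srad smin] ws gE]]] := wg.
case: r s JE sprim srad smin ws gE => [|r] s JE sprim srad smin ws gE.
  by rewrite gE big_ord0 rpred0.
apply/asboolP => K; apply; exists J, w; split=> //.
- apply: (mu_conormal wf Jf (s := s)) ws => i x xJ.
  by have : [set` J] x by []; rewrite JE; exact.
- exact: lifts_spanned wf Jf.
Qed.

Lemma lifted_cycle_homotopy J (w : surjection n J) g : noetherian R ->
    (0 < n)%N -> height J n -> lifts w -> cycle_of w g ->
  homotopy_relations g.
Proof.
move=> noeR n_gt0 Jht [theta [thetaJ thetaw]] wg.
pose f i := theta (basisv i) : R.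
have Jf : [set` J] = spanned (f : 'I_n -> R^o).
  rewrite -thetaJ; apply/seteqP; split=> [_ [v _ <-]|_ [c _ <-]].
    by exists v; rewrite // linear_basis.
  exists [ffun i => c i] => //; rewrite linear_basis.
  by apply: eq_bigr => i _; rewrite ffunE.
have [I [F [Iht IF F0 [i1 Fi1]]]] := homotopy_to_unit noeR n_gt0 Jht Jf.
have I0J : ideal_at I 0 = J.
  apply: ideal_eq; rewrite (ideal_at_spanned 0 IF) Jf.
  by rewrite (_ : (fun i => (F i).[0]) = f) //; apply/funext => i.
have I1 : unit_ideal (ideal_at I 1).
  apply/seteqP; split=> // x _; rewrite (ideal_at_spanned 1 IF).
  exists (fun i => (i == i1)%:R * x) => //.
  rewrite (bigD1 i1) //= eqxx mul1r big1 => [|i /negPf->].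
    by rewrite addr0 Fi1; exact: mulr1.
  by rewrite mul0r scale0r.
have [w1 w1f] := surjection_unit I1.
(* Replacing [J] by [ideal_at I 0] gives [w] the type required of the surjection at that end. *)
subst J; exists I, F, w, w1, g, 0; split=> //.
- by split; [left | right].
- by split=> // i; rewrite F0 -thetaw.
- by split=> //; exact/cycle_of_unit.
- by rewrite subr0.
Qed.

End Symbols.

(** * Equality of the two subgroups and the isomorphism *)

Lemma zmodClosed_eq (V : zmodType) (K K' : zmodClosed V) : K =i K' -> K = K'.
Proof.
move=> KK'; have {KK'} : GRing.ZmodClosed.sort K = GRing.ZmodClosed.sort K'.
  by apply/funext => x; exact: KK'.
case: K K' => [K [[c1] [c2]]] [K' [[c1'] [c2']]] /= KK'.
by subst K'; rewrite (Prop_irrelevance c1 c1') (Prop_irrelevance c2 c2').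
Qed.

(** With the subgroups equal as structures, the quotients are the same type and the identity
    serves. *)
Lemma quot_zmodClosed_eq (V : zmodType) (K K' : zmodClosed V) : K = K' ->
  exists f : {additive Quotient.quot K -> Quotient.quot K'}, bijective f.
Proof. by move=> <-; exists idfun; exists idfun. Qed.

Lemma subgroup_gen_sub (V : zmodType) (A : set V) (K : zmodClosed V) :
  A `<=` [set` K] -> {subset subgroup_gen A <= K}.
Proof. by move=> AK x /asboolP; exact. Qed.

Theorem proposition5p23 (R : comNzRingType) (n : nat)
    (Q_in_R : {rmorphism rat -> R}) :
  noetherian R -> krull_dim R n -> (3 <= n)%N ->
  exists f : {additive homotopy_class_group R n -> euler_class_group R n},
    bijective f.
Proof.
move=> noeR _ n3; apply: quot_zmodClosed_eq; apply: zmodClosed_eq => x.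
(* It suffices that each subgroup contains the generators of the other. *)
apply/idP/idP; apply: subgroup_gen_sub => {}x.
  move=> [I [f [w0 [w1 [g0 [g1 [[_ If] [I0 I1] [w0f w1f] [w0g w1g] ->]]]]]]].
  apply: rpredB.
    exact: (lifted_cycles_endpoint w0f (ideal_at_spanned 0 If)).
  exact: (lifted_cycles_endpoint w1f (ideal_at_spanned 1 If)).
move=> [J [w [Jht _ Jl wg]]]; apply/asboolP => K; apply.
by apply: lifted_cycle_homotopy Jl wg => //; exact: leq_trans n3.
Qed.
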